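(* Given an average preserving WFA $\mathcal{A}$ over $\Sigma=\{0,1\}$ such that $f_{\mathcal{A}}$ is continuous on $\Sigma^\omega$, it is decidable whether the following condition holds: for all finite words $v\in\Sigma^*$, $f_{\mathcal{A}}(v10^\omega)=f_{\mathcal{A}}(v01^\omega)$.
   Context: $\Sigma=\{0,1\}$; $\Sigma^*$ is the set of finite words, $\Sigma^\omega$ the set of infinite words with metric $d_C(w,w')=2^{-k}$, $k$ the length of the longest common prefix of $w\neq w'$; $\mathrm{pref}_k(w)$ is the length-$k$ prefix of $w$. A WFA $\mathcal{A}$ over $\Sigma$ with $n\ge0$ states consists of an initial distribution $I\in\mathbb{R}^{1\times n}$, a final distribution $F\in\mathbb{R}^{n\times1}$ and transition matrices $A_0,A_1\in\mathbb{R}^{n\times n}$; with $A_v=A_{v_1}\cdots A_{v_k}$ for $v=v_1\cdots v_k$, its $\omega$-function is $f_{\mathcal{A}}(w)=\lim_{k\to\infty}IA_{\mathrm{pref}_k(w)}F$, undefined where the limit does not exist; continuity on $\Sigma^\omega$ includes being everywhere defined. $\mathcal{A}$ is average preserving if $A_0F+A_1F=2F$. ''Decidable'' means that there is an algorithm which, given any such $\mathcal{A}$ as input, correctly decides the condition. All matrix and vector entries are given so that exact addition, multiplication, division and equality testing are algorithmic (for example, rational entries). *)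

(* Defs.v *)
(* MathComp / MathComp-Analysis *)
From HB Require Import structures.
From mathcomp Require Import all_boot all_order all_algebra.
From mathcomp Require Import all_classical all_reals all_analysis.

Set Implicit Arguments.
Unset Strict Implicit.
Unset Printing Implicit Defensive.

Import Order.TTheory GRing.Theory Num.Theory.
Import numFieldNormedType.Exports.

(* "Algorithm" is rendered as Kleene's partial recursive functions, given by
   syntax.  A decision procedure presented as a Rocq function would be void of
   computational content, since the logic in use is classical. *)

Inductive recfun : nat -> Type :=
| RZero n : recfun n
| RSucc : recfun 1
| RProj n (i : 'I_n) : recfun n
| RComp m n (f : recfun m) (g : 'I_m -> recfun n) : recfun n
| RPrim n (g : recfun n) (h : recfun n.+2) : recfun n.+1
| RMu n (f : recfun n.+1) : recfun n.

(* [rec_eval p v y]: the computation of p on the arguments v halts with value y.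
   - RPrim g h : F(0, v) = g(v), F(k+1, v) = h(k, F(k, v), v); the sequence s
     is the computation history s k = F(k, v).
   - RMu f : the least y with f(y, v) = 0, all f(k, v), k < y, being defined. *)
Fixpoint rec_eval n (p : recfun n) : n.-tuple nat -> nat -> Prop :=
  match p in recfun n return n.-tuple nat -> nat -> Prop with
  | RZero _ => fun _ y => y = 0
  | RSucc => fun v y => y = (thead v).+1
  | RProj _ i => fun v y => y = tnth v i
  | RComp m _ f g => fun v y =>
      exists2 w : m.-tuple nat,
        forall i, rec_eval (g i) v (tnth w i) & rec_eval f w y
  | RPrim _ g h => fun v y =>
      exists s : nat -> nat,
        [/\ rec_eval g [tuple of behead v] (s 0),
            forall k, k < thead v ->
              rec_eval h [tuple of k :: s k :: behead v] (s k.+1)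
          & y = s (thead v)]
  | RMu _ f => fun v y =>
      rec_eval f [tuple of y :: v] 0 /\
      forall k, k < y -> exists z, rec_eval f [tuple of k :: v] z.+1
  end.

(* Decidability of the property [cond] of inputs satisfying [promise]: one
   program that, on every such input, halts with 1 or 0 accordingly.  Nothing
   is required on inputs violating the promise. *)
Definition decidable_given (X : Type) (enc : X -> nat)
    (promise cond : X -> Prop) : Prop :=
  exists p : recfun 1, forall x, promise x ->
    (cond x -> rec_eval p [tuple enc x] 1) /\ (~ cond x -> rec_eval p [tuple enc x] 0).

Local Open Scope ring_scope.

(* A way of giving real numbers by natural-number codes for which exact
   addition, multiplication, division and equality testing are algorithmic.
   Neither uniqueness of codes nor decidability of being a code is assumed. *)
Definition computes_op (R : realType) (is_code : nat -> Prop) (value : nat -> R)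
    (D : R -> R -> Prop) (op : R -> R -> R) : Prop :=
  exists p : recfun 2, forall a b, is_code a -> is_code b ->
    D (value a) (value b) ->
    exists c, [/\ rec_eval p [tuple a; b] c, is_code c
                & value c = op (value a) (value b)].

Record exact_numbers (R : realType) := ExactNumbers {
  is_code : nat -> Prop;
  value : nat -> R;  (* irrelevant outside is_code *)
  exact_add : computes_op is_code value (fun _ _ => True) (fun x y => x + y);
  exact_mul : computes_op is_code value (fun _ _ => True) (fun x y => x * y);
  exact_div : computes_op is_code value (fun _ y => y != 0) (fun x y => x / y);
  exact_eq : exists p : recfun 2, forall a b, is_code a -> is_code b ->
    rec_eval p [tuple a; b] (value a == value b : nat)
}.

(* The alphabet is bool, with letters 0 = false and 1 = true. *)
Record wfa (T : Type) := WFA {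
  nstates : nat;
  init : 'rV[T]_nstates;
  final : 'cV[T]_nstates;
  trans : bool -> 'M[T]_nstates
}.

Definition map_wfa (T U : Type) (f : T -> U) (A : wfa T) : wfa U :=
  WFA (map_mx f (init A)) (map_mx f (final A))
      (fun a => map_mx f (trans A a)).

Definition wfa_entries (T : Type) (A : wfa T) : seq T :=
  [seq init A ord0 i | i <- enum 'I_(nstates A)] ++
  [seq final A i ord0 | i <- enum 'I_(nstates A)] ++
  [seq trans A false i j | i <- enum 'I_(nstates A), j <- enum 'I_(nstates A)] ++
  [seq trans A true i j | i <- enum 'I_(nstates A), j <- enum 'I_(nstates A)].

Definition encode_wfa (A : wfa nat) : nat :=
  CodeSeq.code (nstates A :: wfa_entries A).

Definition well_coded (R : realType) (N : exact_numbers R) (A : wfa nat) : Prop :=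
  forall c, c \in wfa_entries A -> is_code N c.

Definition denote_wfa (R : realType) (N : exact_numbers R) (A : wfa nat) : wfa R :=
  map_wfa (value N) A.

Definition word := seq bool.
Definition oword := nat -> bool.

Definition pref (k : nat) (w : oword) : word := mkseq w k.

Definition cat_oword (v : word) (w : oword) : oword :=
  fun i => if (i < size v)%N then nth false v i else w (i - size v)%N.

Definition omega_letter (a : bool) : oword := fun=> a.

Definition trans_word (R : realType) (A : wfa R) (v : word) : 'M[R]_(nstates A) :=
  \big[mulmx/1%:M]_(a <- v) trans A a.

Definition prefix_value (R : realType) (A : wfa R) (w : oword) : nat -> R :=
  fun k => (init A *m trans_word A (pref k w) *m final A) ord0 ord0.

Definition omega_defined (R : realType) (A : wfa R) (w : oword) : Prop :=
  cvgn (prefix_value A w).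

(* Meaningful only where omega_defined. *)
Definition omega_fun (R : realType) (A : wfa R) (w : oword) : R :=
  limn (prefix_value A w).

(* The length of the longest common prefix of two distinct infinite words is
   the least index at which they differ. *)
Definition dC (R : realType) (w w' : oword) : R :=
  match pselect (exists k, w k != w' k) with
  | left neq => 2^-1 ^+ ex_minn neq
  | right _ => 0
  end.

Definition omega_continuous (R : realType) (A : wfa R) : Prop :=
  (forall w, omega_defined A w) /\
  forall w (e : R), 0 < e ->
    exists2 d : R, 0 < d &
      forall w', dC R w w' < d -> `|omega_fun A w - omega_fun A w'| < e.

Definition average_preserving (R : realType) (A : wfa R) : Prop :=
  trans A false *m final A + trans A true *m final A = 2 *: final A.

Definition binary_compatible (R : realType) (A : wfa R) : Prop :=
  forall v : word,
    omega_fun A (cat_oword (v ++ [:: true]) (omega_letter false)) =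
    omega_fun A (cat_oword (v ++ [:: false]) (omega_letter true)).

(* Main.v *)
Require Import Defs.
From mathcomp Require Import all_boot all_order all_algebra.
From mathcomp Require Import all_classical all_reals all_analysis.

(** For a finite word v put c_v(k) = I A_v (A_1 A_0^k - A_0 A_1^k) F.  The
    condition says that the limit of c_v is 0 for every v; the limit exists as
    soon as the omega-function is everywhere defined.

    By Cayley-Hamilton, every c_v satisfies the linear recurrence with
    characteristic polynomial P = chi_{A_0} chi_{A_1}, of degree d = 2n.  Write
    P = (X - 1)^m q with q(1) <> 0.  A convergent sequence killed by a power of
    (shift - 1) is constant, so q(shift) c_v is the constant sequence
    q(1) lim c_v.  This has two consequences.  First, lim c_v is I A_v y for a
    vector y independent of v, so that only the words v of length at most n
    matter.  Second, dividing q - q(1) by X - 1 shows that lim c_v = 0 if and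
    only if the vector (c_v(0), ..., c_v(d-1)) is a linear combination of the
    d vectors obtained by shifting the difference sequence of c_v, which
    fraction-free elimination decides. *)

Set Implicit Arguments.
Unset Strict Implicit.
Unset Printing Implicit Defensive.

Import Order.TTheory GRing.Theory Num.Theory.
Import numFieldNormedType.Exports.

(** * Computability relative to codings *)

(* Codes need not be unique, so that a program is allowed to compute different
   codes of the same object from different codes of its arguments. *)
Record coded := Coded { carrier :> Type; codes : nat -> carrier -> Prop }.

(* The arguments of a program are the codes of the variables in scope, the most
   recent one first; [ctype] is the type of environments. *)
Record context (k : nat) := Context {
  ctype :> Type;
  crel : ctype -> k.-tuple nat -> Prop
}.

Definition emp : context 0 := @Context 0 unit (fun _ _ => True).

Definition ext k (E : context k) (T : coded) : context k.+1 :=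
  @Context k.+1 (ctype E * carrier T)
    (fun e v => codes (thead v) e.2 /\ crel e.1 [tuple of behead v]).

(** A promise on the environment: where [P] fails, a program for a map on the restricted context may
    give any answer or none. *)
Definition restrict k (E : context k) (P : E -> Prop) : context k :=
  @Context k (ctype E) (fun e v => crel e v /\ P e).

Definition computable k (E : context k) (T : coded) (f : E -> T) : Prop :=
  exists p : recfun k, forall e v, crel e v ->
    exists2 c, rec_eval p v c & codes c (f e).

Definition natC := Coded (fun c (m : nat) => c = m).
Definition boolC := Coded (fun c (b : bool) => c = b :> nat).

Lemma computable_ext k (E : context k) (T : coded) (f g : E -> T) :
  f =1 g -> computable f -> computable g.
Proof. by move=> /funext ->. Qed.

(** Simulation: the program of [f'] also serves for [f], since the arguments given to [f] code an
    environment of [f'] as well. *)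
Lemma computable_refine k (E E' : context k) (T T' : coded)
    (f' : E' -> T') (f : E -> T) :
  (forall e v, crel e v -> exists2 e', crel e' v &
     forall c, codes c (f' e') -> codes c (f e)) ->
  computable f' -> computable f.
Proof.
move=> fP [p pP]; exists p => e v /fP[e' /pP[c pc cf'] sub].
by exists c => //; exact: sub.
Qed.

Lemma computable_restrict k (E : context k) (P : E -> Prop) (T : coded)
    (f : E -> T) : computable f -> computable (f : restrict P -> T).
Proof. by move=> [p pP]; exists p => e v [/pP]. Qed.

Lemma computable_var k (E : context k) (T : coded) :
  computable (fun e : ext E T => e.2).
Proof.
exists (RProj ord0) => -[e t] v /= [ct _].
by exists (tnth v ord0) => //; rewrite -[tnth _ _]/(thead v).
Qed.

Lemma computable_weaken k (E : context k) (T U : coded) (f : E -> U) :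
  computable f -> computable (fun e : ext E T => f e.1).
Proof.
move=> [p pP]; exists (RComp p (fun i => RProj (lift ord0 i))).
move=> [e t] v /= [_ /pP[c pc cf]]; exists c => //.
exists [tuple of behead v] => // i.
rewrite tnth_behead; congr tnth; apply/val_inj.
by rewrite /= /bump /= add1n inordK // ltnS ltn_ord.
Qed.

(** The new variable goes just below the most recent one, as happens when a body with an index is
    reused inside a loop with an accumulator. *)
Lemma computable_weaken_under k (E : context k) (T U V : coded)
    (f : E -> U -> V) :
  computable (fun e : ext E U => f e.1 e.2) ->
  computable (fun e : ext (ext E T) U => f e.1.1 e.2).
Proof.
move=> [p pP]; exists (RComp p (fun i => RProj (lift (lift ord0 ord0) i))).
move=> [[e t] u] v /= [cu [_ ce]].
have [|c pc cf] := pP (e, u) [tuple of thead v :: behead (behead v)].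
  rewrite /= theadE; split=> //.
  by congr (crel e): ce; exact/val_inj.
exists c => //; exists [tuple of thead v :: behead (behead v)] => // i.
case: (unliftP ord0 i) => [j ->|->]; rewrite ?tnth0 ?tnthS.
  rewrite !tnth_behead; congr tnth; apply/val_inj.
  by rewrite /= !inordK /bump /= ?add1n ?ltnS ?ltn_ord.
by rewrite /thead; congr tnth; exact/val_inj.
Qed.

Lemma computable_let k (E : context k) (T U : coded) (f : E -> T)
    (g : ext E T -> U) :
  computable f -> computable g -> computable (fun e => g (e, f e)).
Proof.
move=> [p pP] [q qP].
exists (RComp q (fun i => if unlift ord0 i is Some j then RProj j else p)).
move=> e v ev; have [c pc cf] := pP e v ev.
have [|b qb bg] := qP (e, f e) [tuple of c :: v].
  rewrite /= theadE; split=> //.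
  by congr (crel e): ev; apply/val_inj.
exists b => //=; exists [tuple of c :: v] => // i.
by case: unliftP => [j ->|->] //=; rewrite tnthS.
Qed.

(** [RPrim] runs its step only at indices below the bound, so [h] has to be computable only there.
    This makes guarded branches possible. *)
Lemma computable_iteri_lt k (E : context k) (T : coded) (b : E -> nat)
    (g : E -> T) (h : E -> nat -> T -> T) :
  computable (b : E -> natC) -> computable g ->
  computable (fun e : restrict
    (fun e : ext (ext E T) natC => e.2 < b e.1.1) => h e.1.1 e.2 e.1.2) ->
  computable (fun e => iteri (b e) (fun i t => h e i t) (g e)).
Proof.
move=> [pb bP] [pg gP] [ph hP].
exists (RComp (RPrim pg ph)
  (fun i => if unlift ord0 i is Some j then RProj j else pb)).
move=> e v ev; have [_ /[swap] /= -> pb_v] := bP e v ev.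
pose it i := iteri i (fun i t => h e i t) (g e).
have beheadK a : [tuple of behead [tuple of a :: v]] = v by exact/val_inj.
(* Codes are not unique, so the history is not determined by the iterates; it is extended by one
   chosen code at a time. *)
have hist m : m <= b e -> exists s : nat -> nat, [/\ rec_eval pg v (s 0),
    forall i, i < m -> rec_eval ph [tuple of i :: s i :: v] (s i.+1)
    & forall i, i <= m -> codes (s i) (it i)]; last first.
  have [s [s0 sS sP]] := hist _ (leqnn _).
  exists (s (b e)); last exact: sP.
  exists [tuple of b e :: v].
    by move=> i; case: unliftP => [j ->|->]; [rewrite /= tnthS | rewrite tnth0].
  exists s; rewrite theadE beheadK; split=> // i ib.
  by rewrite (_ : [tuple of _] = [tuple of [:: i, s i & v]]);
    [exact: sS | exact/val_inj].
elim: m => [_|m IHm mb].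
  by have [c pc cg] := gP e v ev; exists (fun=> c); split=> // i; case: i.
have [s [s0 sS sP]] := IHm (ltnW mb).
have [|c pc cm] := hP ((e, it m), m) [tuple of m :: s m :: v].
  rewrite /= !theadE; split=> //; split=> //; split; first exact: sP.
  by congr crel: ev; exact/val_inj.
exists (fun i => if i <= m then s i else c); split=> // i.
  rewrite ltnS => im; rewrite im.
  by case: ltngtP im => // [im _|-> _]; [exact: sS | exact: pc].
rewrite leq_eqVlt => /predU1P[->|]; first by rewrite ltnn.
by rewrite ltnS => im; rewrite im; exact: sP.
Qed.

Lemma computable_iteri k (E : context k) (T : coded) (b : E -> nat)
    (g : E -> T) (h : E -> nat -> T -> T) :
  computable (b : E -> natC) -> computable g ->
  computable (fun e : ext (ext E T) natC => h e.1.1 e.2 e.1.2) ->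
  computable (fun e => iteri (b e) (fun i t => h e i t) (g e)).
Proof. by move=> bP gP hP; apply/computable_iteri_lt/computable_restrict. Qed.

Lemma computable_zero k (E : context k) : computable ((fun=> 0) : E -> natC).
Proof. by exists (RZero k) => e v _; exists 0. Qed.

Lemma computable_op2 k (E : context k) (T U V : coded) (P : T -> U -> Prop)
    (g : T -> U -> V) (p : recfun 2) (f : E -> T) (h : E -> U) :
  (forall a b t u, codes a t -> codes b u -> P t u ->
    exists2 c, rec_eval p [tuple a; b] c & codes c (g t u)) ->
  (forall e v, crel e v -> P (f e) (h e)) ->
  computable f -> computable h -> computable (fun e => g (f e) (h e)).
Proof.
move=> pP Pfh [pf fP] [ph hP].
exists (RComp p (fun i : 'I_2 => if i == 0 :> nat then pf else ph)).
move=> e v ev; have [a pa af] := fP e v ev; have [b pb bh] := hP e v ev.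
have [c pc cg] := pP a b _ _ af bh (Pfh e v ev).
by exists c => //; exists [tuple a; b] => // -[[|[|]]].
Qed.

Lemma computable_op1 k (E : context k) (T V : coded)
    (g : T -> V) (p : recfun 1) (f : E -> T) :
  (forall a t, codes a t -> exists2 c, rec_eval p [tuple a] c & codes c (g t)) ->
  computable f -> computable (fun e => g (f e)).
Proof.
move=> pP [pf fP]; exists (RComp p (fun=> pf)).
move=> e v ev; have [a pa af] := fP e v ev; have [c pc cg] := pP a _ af.
by exists c => //; exists [tuple a] => // -[[|]].
Qed.

Lemma computable_succ k (E : context k) (f : E -> nat) :
  computable (f : E -> natC) -> computable ((fun e => (f e).+1) : E -> natC).
Proof.
by apply: (@computable_op1 _ _ natC natC S RSucc) => a t ->; exists t.+1.
Qed.

(** It suffices to track [g] on codes by a function [g0] on numbers. In the context with a single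
    variable, the closure property of [g0] yields the program. *)
Lemma computable_realize1 (T V : coded) (g : T -> V) (g0 : nat -> nat) :
  (forall k (E : context k) (f : E -> nat),
    computable (f : E -> natC) -> computable ((fun e => g0 (f e)) : E -> natC)) ->
  (forall a t, codes a t -> codes (g0 a) (g t)) ->
  forall k (E : context k) (f : E -> T),
    computable f -> computable (fun e => g (f e)).
Proof.
move=> g0P gP k E f; have [p pP] := g0P _ _ _ (computable_var emp natC).
apply: (computable_op1 (p := p)) => a t /gP ct; exists (g0 a) => //.
by have [|_ /[swap] /= ->] := pP (tt, a) [tuple a].
Qed.

Lemma computable_realize2 (T U V : coded) (g : T -> U -> V)
    (g0 : nat -> nat -> nat) :
  (forall k (E : context k) (f h : E -> nat),
    computable (f : E -> natC) -> computable (h : E -> natC) ->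
    computable ((fun e => g0 (f e) (h e)) : E -> natC)) ->
  (forall a b t u, codes a t -> codes b u -> codes (g0 a b) (g t u)) ->
  forall k (E : context k) (f : E -> T) (h : E -> U),
    computable f -> computable h -> computable (fun e => g (f e) (h e)).
Proof.
move=> g0P gP k E f h.
have [p pP] := g0P _ _ _ _ (computable_var (ext emp natC) natC)
  (computable_weaken natC (computable_var emp natC)).
apply: (@computable_op2 _ _ _ _ _ (fun _ _ => True) _ p) => //.
move=> a b t u ct cu _; exists (g0 a b); last exact: gP.
by have [|_ /[swap] /= ->] := pP ((tt, b), a) [tuple a; b].
Qed.

Lemma computable_const k (E : context k) m :
  computable ((fun=> m) : E -> natC).
Proof.
by elim: m => [|m IHm]; [exact: computable_zero | exact: computable_succ].
Qed.

(* [f] is run only where [b] holds; it need not even have a code elsewhere. *)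
Lemma computable_if_lt k (E : context k) (T : coded) (b : E -> bool)
    (f g : E -> T) :
  computable (b : E -> boolC) -> computable (f : restrict b -> T) ->
  computable g -> computable (fun e => if b e then f e else g e).
Proof.
move=> bP fP gP.
(* A conditional is a loop of 0 or 1 rounds. *)
apply: (@computable_ext _ _ _
  (fun e => iteri (b e : nat) (fun _ _ => f e) (g e))).
  by move=> e; case: (b e).
apply: computable_iteri_lt => //.
apply: computable_refine
  (computable_weaken natC (computable_weaken T fP)) => e v /= [[ci [ct ce]] lt_b].
exists e => //=; split=> //; split=> //; split=> //.
by case: (b e.1.1) lt_b.
Qed.

Lemma computable_if k (E : context k) (T : coded) (b : E -> bool)
    (f g : E -> T) :
  computable (b : E -> boolC) -> computable f ->
  computable g -> computable (fun e => if b e then f e else g e).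
Proof. by move=> bP fP; apply/computable_if_lt/computable_restrict. Qed.

Lemma computable_all k (E : context k) (b : E -> nat) (P : E -> nat -> bool) :
  computable (b : E -> natC) ->
  computable ((fun e => P e.1 e.2) : ext E natC -> boolC) ->
  computable ((fun e => all (P e) (iota 0 (b e))) : E -> boolC).
Proof.
move=> bP PP.
apply: (@computable_ext _ _ _ (fun e => iteri (b e)
    (fun i (t : boolC) => if P e i then t else false) true)).
  move=> e; elim: (b e) => // m IHm.
  rewrite [LHS]/= IHm -[m.+1]addn1 iotaD all_cat /= andbT add0n.
  by case: (P e m); rewrite ?andbT ?andbF.
have boolP k' (E' : context k') (c : bool) : computable ((fun=> c) : E' -> boolC).
  by have [p pP] := computable_const E' c; exists p.
apply: computable_iteri => //; apply: computable_if => //.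
  exact: computable_weaken_under PP.
exact/computable_weaken/computable_var.
Qed.

(** * Arithmetic of natural numbers *)

Lemma computable_pred k (E : context k) (f : E -> nat) :
  computable (f : E -> natC) -> computable ((fun e => (f e).-1) : E -> natC).
Proof.
move=> fP; apply: (@computable_ext _ _ _
  (fun e => iteri (f e) (fun i (_ : natC) => i) 0)); first by move=> e; case: (f e).
apply: computable_iteri => //; first exact: computable_zero.
exact: computable_var.
Qed.

Lemma computable_addn k (E : context k) (f g : E -> nat) :
  computable (f : E -> natC) -> computable (g : E -> natC) ->
  computable ((fun e => f e + g e) : E -> natC).
Proof.
move=> fP gP; apply: (@computable_ext _ _ _
  (fun e => iteri (f e) (fun _ (t : natC) => t.+1) (g e))).
  by move=> e; elim: (f e) => //= m ->.
apply: computable_iteri => //.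
exact/computable_succ/computable_weaken/computable_var.
Qed.

Lemma computable_subn k (E : context k) (f g : E -> nat) :
  computable (f : E -> natC) -> computable (g : E -> natC) ->
  computable ((fun e => f e - g e) : E -> natC).
Proof.
move=> fP gP; apply: (@computable_ext _ _ _
  (fun e => iteri (g e) (fun _ (t : natC) => t.-1) (f e))).
  by move=> e; elim: (g e) => [|m]; rewrite ?subn0 //= => ->; rewrite subnS.
apply: computable_iteri => //.
exact/computable_pred/computable_weaken/computable_var.
Qed.

Lemma computable_muln k (E : context k) (f g : E -> nat) :
  computable (f : E -> natC) -> computable (g : E -> natC) ->
  computable ((fun e => f e * g e) : E -> natC).
Proof.
move=> fP gP; apply: (@computable_ext _ _ _
  (fun e => iteri (f e) (fun _ (t : natC) => g e + t) 0)).
  by move=> e; elim: (f e) => //= m ->; rewrite mulSn.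
apply: computable_iteri => //; first exact: computable_zero.
apply: computable_addn; first exact: computable_weaken (computable_weaken _ gP).
exact/computable_weaken/computable_var.
Qed.

Lemma computable_exp2 k (E : context k) (f : E -> nat) :
  computable (f : E -> natC) -> computable ((fun e => 2 ^ f e) : E -> natC).
Proof.
move=> fP; apply: (@computable_ext _ _ _
  (fun e => iteri (f e) (fun _ (t : natC) => t + t) 1)).
  by move=> e; elim: (f e) => //= m ->; rewrite expnS mul2n addnn.
apply: computable_iteri => //; first exact: computable_const.
by apply: computable_addn; exact/computable_weaken/computable_var.
Qed.

Lemma computable_bool k (E : context k) (f : E -> bool) :
  computable (f : E -> boolC) <-> computable ((fun e => f e) : E -> natC).
Proof. by split=> -[p pP]; exists p. Qed.

Lemma computable_eq0 k (E : context k) (f : E -> nat) :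
  computable (f : E -> natC) -> computable ((fun e => f e == 0) : E -> boolC).
Proof.
move=> fP; apply/computable_bool.
apply: (@computable_ext _ _ natC (fun e => 1 - f e)).
  by move=> e; case: (f e).
by apply: computable_subn => //; exact: computable_const.
Qed.

Lemma computable_negb k (E : context k) (f : E -> bool) :
  computable (f : E -> boolC) -> computable ((fun e => ~~ f e) : E -> boolC).
Proof.
move=> /computable_bool fP; apply/computable_bool.
apply: (@computable_ext _ _ natC (fun e => 1 - f e)).
  by move=> e; case: (f e).
by apply: computable_subn => //; exact: computable_const.
Qed.

Lemma computable_leq k (E : context k) (f g : E -> nat) :
  computable (f : E -> natC) -> computable (g : E -> natC) ->
  computable ((fun e => f e <= g e) : E -> boolC).
Proof. by move=> fP gP; exact/computable_eq0/computable_subn. Qed.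

Lemma computable_odd k (E : context k) (f : E -> nat) :
  computable (f : E -> natC) -> computable ((fun e => odd (f e)) : E -> boolC).
Proof.
move=> fP; apply: (@computable_ext _ _ _
  (fun e => iteri (f e) (fun _ (t : boolC) => ~~ t) false)).
  by move=> e; elim: (f e) => //= m ->.
apply: computable_iteri => //.
  by apply/computable_bool; exact: computable_zero.
exact/computable_negb/computable_weaken/computable_var.
Qed.

Lemma computable_count k (E : context k) (b : E -> nat) (P : E -> nat -> bool) :
  computable (b : E -> natC) ->
  computable ((fun e => P e.1 e.2) : ext E natC -> boolC) ->
  computable ((fun e => count (P e) (iota 0 (b e))) : E -> natC).
Proof.
move=> bP PP.
apply: (@computable_ext _ _ _ (fun e => iteri (b e)
    (fun i (t : natC) => t + P e i) 0)).
  move=> e; elim: (b e) => // m IHm.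
  by rewrite [LHS]/= IHm -[m.+1]addn1 iotaD count_cat /= addn0.
apply: computable_iteri => //; first exact: computable_zero.
apply: computable_addn; first exact/computable_weaken/computable_var.
apply/(computable_bool (E := ext (ext E natC) natC)
  (fun e : ext (ext E natC) natC => P e.1.1 e.2)).
exact: computable_weaken_under PP.
Qed.

Lemma computable_divn k (E : context k) (f g : E -> nat) :
  computable (f : E -> natC) -> computable (g : E -> natC) ->
  computable ((fun e => f e %/ g e) : E -> natC).
Proof.
(* The quotient counts the positive multiples of [g e] up to [f e]. The guard matters: for divisor 0
   the count would be [f e], while [%/] gives 0. *)
move=> fP gP; apply: (@computable_ext _ _ natC (fun e => if g e == 0 then 0 else
    count (fun i => i.+1 * g e <= f e) (iota 0 (f e)))).
  move=> e; case: posnP => [->|g0]; first by rewrite divn0.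
  rewrite (@eq_count _ _ (fun i => i < f e %/ g e)); last first.
    by move=> i; rewrite leq_divRL.
  have := leq_div (f e) (g e); elim: (f e) (f e %/ g e) => [[]//|m IHm d].
  rewrite -[X in iota _ X]addn1 iotaD count_cat /= addn0 add0n.
  rewrite leq_eqVlt => /predU1P[->|]; last first.
    by rewrite !ltnS => dm; rewrite IHm // ltnNge dm addn0.
  rewrite ltnSn (@eq_in_count _ _ predT) ?count_predT ?size_iota ?addn1 //.
  by move=> i; rewrite mem_iota add0n => /andP[_ /leqW].
apply: computable_if; [exact: computable_eq0 | exact: computable_zero |].
apply: computable_count => //.
apply: computable_leq; last exact: computable_weaken.
apply: computable_muln; last exact: computable_weaken.
by apply: computable_succ; exact: computable_var.
Qed.

(* The pairing underlying CodeSeq: [code (a :: s) = consn a (code s)]. *)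
Definition consn (a b : nat) : nat := 2 ^ a * b.*2.+1.
(** The 2-adic valuation as a bounded count; the range suffices because the valuation of a positive
    [m] is below [m]. *)
Definition headn (m : nat) : nat := count (fun i => 2 ^ i.+1 %| m) (iota 0 m).
Definition beheadn (m : nat) : nat := (m %/ 2 ^ headn m) %/ 2.

Lemma headnK a b : headn (consn a b) = a.
Proof.
(* The factor [b.*2.+1] is odd, so [2 ^ i.+1] divides the code exactly when [i < a]. *)
rewrite /headn (@eq_count _ _ (fun i => i < a)); last first.
  move=> i; rewrite /consn Gauss_dvdl ?dvdn_Pexp2l //.
  by rewrite coprimeXl // coprime2n /= odd_double.
have ac : a <= consn a b.
  by rewrite (leq_trans (ltnW (ltn_expl a (isT : 1 < 2)))) ?leq_pmulr.
rewrite -(subnKC ac) iotaD count_cat.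
rewrite (eq_in_count (a2 := predT)) => [|i]; last first.
  by rewrite mem_iota.
rewrite count_predT size_iota (eq_in_count (a2 := pred0)) => [|i]; last first.
  by rewrite mem_iota add0n => /andP[ai _]; rewrite /= ltnNge ai.
by rewrite count_pred0 addn0.
Qed.

Lemma beheadnK a b : beheadn (consn a b) = b.
Proof.
by rewrite /beheadn headnK mulKn ?expn_gt0 // divn2 /= uphalf_double.
Qed.

Lemma computable_consn k (E : context k) (f g : E -> nat) :
  computable (f : E -> natC) -> computable (g : E -> natC) ->
  computable ((fun e => consn (f e) (g e)) : E -> natC).
Proof.
move=> fP gP; apply: (@computable_ext _ _ natC
  (fun e => 2 ^ f e * (g e + g e).+1)); first by move=> e; rewrite addnn.
apply: computable_muln; first exact: computable_exp2.
exact/computable_succ/computable_addn.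
Qed.

Lemma computable_headn k (E : context k) (f : E -> nat) :
  computable (f : E -> natC) -> computable ((fun e => headn (f e)) : E -> natC).
Proof.
move=> fP; apply: computable_count => //.
apply: (@computable_ext _ (ext E natC) boolC
  (fun e => f e.1 <= f e.1 %/ 2 ^ e.2.+1 * 2 ^ e.2.+1)).
  by move=> e; rewrite dvdn_eq eqn_leq leq_trunc_div.
have fwP := computable_weaken natC fP.
have pP : computable ((fun e => 2 ^ e.2.+1) : ext E natC -> natC).
  exact/computable_exp2/computable_succ/computable_var.
exact/computable_leq/computable_muln/pP/computable_divn.
Qed.

Lemma computable_beheadn k (E : context k) (f : E -> nat) :
  computable (f : E -> natC) -> computable ((fun e => beheadn (f e)) : E -> natC).
Proof.
move=> fP; apply: computable_divn; last exact: computable_const.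
by apply: computable_divn => //; exact/computable_exp2/computable_headn.
Qed.

(** * Codes of pairs and of finite sequences *)

Definition pairC (T U : coded) := Coded (fun c (p : T * U) =>
  exists2 ab, c = consn ab.1 ab.2 & codes ab.1 p.1 /\ codes ab.2 p.2).

Lemma computable_pair k (E : context k) (T U : coded) (f : E -> T) (g : E -> U) :
  computable f -> computable g ->
  computable ((fun e => (f e, g e)) : E -> pairC T U).
Proof.
apply: (@computable_realize2 T U (pairC T U) pair consn computable_consn).
by move=> a b t u at_ bu; exists (a, b).
Qed.

Lemma computable_fst k (E : context k) (T U : coded) (f : E -> T * U) :
  computable (f : E -> pairC T U) -> computable ((fun e => (f e).1) : E -> T).
Proof.
apply: (@computable_realize1 (pairC T U) T fst headn computable_headn).
by move=> _ t [[a b] /= -> [ca cb]]; rewrite headnK.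
Qed.

Lemma computable_snd k (E : context k) (T U : coded) (f : E -> T * U) :
  computable (f : E -> pairC T U) -> computable ((fun e => (f e).2) : E -> U).
Proof.
apply: (@computable_realize1 (pairC T U) U snd beheadn computable_beheadn).
by move=> _ t [[a b] /= -> [ca cb]]; rewrite beheadnK.
Qed.

(** The format of [CodeSeq.code], except that each element may appear under any of its codes. As
    [consn] is never 0, the code 0 singles out the empty sequence. *)
Fixpoint seq_codes (T : coded) (c : nat) (s : seq T) : Prop :=
  if s is t :: s' then
    exists2 ab, c = consn ab.1 ab.2 & codes ab.1 t /\ seq_codes ab.2 s'
  else c = 0.
Definition seqC (T : coded) := Coded (@seq_codes T).

Lemma computable_nil k (E : context k) (T : coded) :
  computable ((fun=> [::]) : E -> seqC T).
Proof. by have [p pP] := computable_zero E; exists p. Qed.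

Lemma computable_cons k (E : context k) (T : coded) (f : E -> T)
    (g : E -> seq T) :
  computable f -> computable (g : E -> seqC T) ->
  computable ((fun e => f e :: g e) : E -> seqC T).
Proof.
apply: (@computable_realize2 T (seqC T) (seqC T) cons consn computable_consn).
by move=> a b t u at_ bu; exists (a, b).
Qed.

Lemma computable_behead k (E : context k) (T : coded) (f : E -> seq T) :
  computable (f : E -> seqC T) ->
  computable ((fun e => behead (f e)) : E -> seqC T).
Proof.
apply: (@computable_realize1 (seqC T) (seqC T) behead beheadn computable_beheadn).
by move=> c [->//|t s [[a b] /= -> [ca cb]]]; rewrite beheadnK.
Qed.

Lemma computable_head k (E : context k) (T : coded) (d : E -> T)
    (f : E -> seq T) :
  computable d -> computable (f : E -> seqC T) ->
  computable ((fun e => head (d e) (f e)) : E -> T).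
Proof.
apply: (@computable_realize2 T (seqC T) T head
  (fun a c => if c == 0 then a else headn c)); last first.
  move=> a c t [|u s] ct /=; first by move=> ->.
  move=> [[b c'] /= -> [cu _]]; rewrite headnK ifF //.
  by rewrite /consn muln_eq0 expn_eq0.
move=> m E' g h gP hP.
by apply: computable_if; [exact: computable_eq0 | | exact: computable_headn].
Qed.

Lemma computable_nth k (E : context k) (T : coded) (d : E -> T)
    (f : E -> seq T) (i : E -> nat) :
  computable d -> computable (f : E -> seqC T) -> computable (i : E -> natC) ->
  computable ((fun e => nth (d e) (f e) (i e)) : E -> T).
Proof.
move=> dP fP iP; apply: (@computable_ext _ _ _ (fun e => head (d e)
    (iteri (i e) (fun _ (s : seqC T) => behead s) (f e)))).
  move=> e; rewrite -nth0 -[in RHS](addn0 (i e)).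
  elim: (i e) 0 => [|m IHm] j //; rewrite [iteri _ _ _]/= nth_behead IHm.
  by rewrite addnS addSn.
apply: computable_head => //; apply: computable_iteri => //.
exact/computable_behead/computable_weaken/computable_var.
Qed.

Lemma computable_mkseq k (E : context k) (T : coded) (b : E -> nat)
    (f : E -> nat -> T) :
  computable (b : E -> natC) ->
  computable (fun e : ext E natC => f e.1 e.2) ->
  computable ((fun e => mkseq (f e) (b e)) : E -> seqC T).
Proof.
(* Consing builds the sequence from its end: round [i] computes the entry of index [b e - i.+1], and
   [m] rounds give the last [m] entries. *)
move=> bP fP; apply: (@computable_ext _ _ _ (fun e => iteri (b e)
    (fun i (s : seqC T) => f e (b e - i.+1) :: s) [::])).
  move=> e; suff dropE m : m <= b e ->
      iteri m (fun i (s : seqC T) => f e (b e - i.+1) :: s) [::] =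
      drop (b e - m) (mkseq (f e) (b e)).
    by rewrite dropE // subnn drop0.
  elim: m => [_|m IHm mb].
    by rewrite subn0 drop_oversize ?size_mkseq.
  have lt_b : b e - m.+1 < b e by rewrite ltn_subrL (leq_trans _ mb).
  rewrite [LHS]/= IHm ?(ltnW mb) // [RHS](drop_nth (f e 0)) ?size_mkseq //.
  by rewrite nth_mkseq // -(subSn mb) subSS.
apply: computable_iteri => //; first exact: computable_nil.
apply: computable_cons; last exact/computable_weaken/computable_var.
apply: (computable_let (E := ext (ext E (seqC T)) natC) (T := natC)
  (f := fun e => b e.1.1 - e.2.+1) (g := fun e => f e.1.1.1 e.2)).
  apply: computable_subn; first exact: computable_weaken (computable_weaken _ bP).
  exact/computable_succ/computable_var.
apply: (@computable_weaken_under _ (ext E (seqC T)) natC natC T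
  (fun e i => f e.1 i)).
exact: computable_weaken_under.
Qed.

(** * Exact arithmetic *)

Section ExactReals.
Variables (R : realType) (N : exact_numbers R).
Local Open Scope ring_scope.

Definition rawC := Coded (fun c (r : R) => is_code N c /\ value N c = r).

(* [exact_numbers] provides neither a zero nor a subtraction, so a real is
   represented by a pair of codes whose values have it as difference. *)
Definition realC := Coded (fun c (r : R) =>
  exists2 t : pairC rawC rawC, codes c t & r = t.1 - t.2).

Lemma computable_raw_add k (E : context k) (f g : E -> R) :
  computable (f : E -> rawC) -> computable (g : E -> rawC) ->
  computable ((fun e => f e + g e) : E -> rawC).
Proof.
have [p pP] := exact_add N.
apply: (@computable_op2 _ _ rawC rawC rawC (fun _ _ => True) +%R p) => //.
move=> a b _ _ [ca <-] [cb <-] _; have [c [pc cc cE]] := pP a b ca cb I.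
by exists c.
Qed.

Lemma computable_raw_mul k (E : context k) (f g : E -> R) :
  computable (f : E -> rawC) -> computable (g : E -> rawC) ->
  computable ((fun e => f e * g e) : E -> rawC).
Proof.
have [p pP] := exact_mul N.
apply: (@computable_op2 _ _ rawC rawC rawC (fun _ _ => True) *%R p) => //.
move=> a b _ _ [ca <-] [cb <-] _; have [c [pc cc cE]] := pP a b ca cb I.
by exists c.
Qed.

Lemma computable_raw_eq k (E : context k) (f g : E -> R) :
  computable (f : E -> rawC) -> computable (g : E -> rawC) ->
  computable ((fun e => f e == g e) : E -> boolC).
Proof.
have [p pP] := exact_eq N.
apply: (@computable_op2 _ _ rawC rawC boolC (fun _ _ => True) eq_op p) => //.
move=> a b _ _ [ca <-] [cb <-] _.
by exists (value N a == value N b : nat) => //; exact: pP.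
Qed.

(** With no code of 0 at hand, [f] is written as [(f + f) - f]. *)
Lemma computable_raw_real k (E : context k) (f : E -> R) :
  computable (f : E -> rawC) -> computable (f : E -> realC).
Proof.
move=> fP; have [p pP] := computable_pair (computable_raw_add fP fP) fP.
exists p => e v /pP[c pc cf]; exists c => //.
by exists (f e + f e, f e); rewrite //= addrK.
Qed.

Lemma computable_real0 k (E : context k) (f : E -> R) :
  computable (f : E -> rawC) -> computable ((fun=> 0) : E -> realC).
Proof.
move=> fP; have [p pP] := computable_pair fP fP.
exists p => e v /pP[c pc cf]; exists c => //.
by exists (f e, f e); rewrite //= subrr.
Qed.

(** Operations on differences are computed on the representing pairs by [g']; sum, difference,
    product and equality test are all obtained in this way. *)
Lemma computable_pair_op2 (V V' : coded) (g : R -> R -> V)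
    (g' : R * R -> R * R -> V') :
  (forall k (E : context k) (f h : E -> R * R),
    computable (f : E -> pairC rawC rawC) ->
    computable (h : E -> pairC rawC rawC) ->
    computable (fun e => g' (f e) (h e))) ->
  (forall c t u, codes c (g' t u) -> codes c (g (t.1 - t.2) (u.1 - u.2))) ->
  forall k (E : context k) (f h : E -> R),
    computable (f : E -> realC) -> computable (h : E -> realC) ->
    computable (fun e => g (f e) (h e)).
Proof.
move=> g'P gP k E f h; pose P := pairC rawC rawC.
have [p pP] := g'P _ _ _ _ (computable_var (ext emp P) P)
  (computable_weaken P (computable_var emp P)).
apply: (@computable_op2 _ _ realC realC _ (fun _ _ => True) _ p) => //.
move=> a b _ _ [t ct ->] [u cu ->] _.
by have [|c pc /gP] := pP ((tt, u), t) [tuple a; b]; last by exists c.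
Qed.

Lemma computable_real_add k (E : context k) (f g : E -> R) :
  computable (f : E -> realC) -> computable (g : E -> realC) ->
  computable ((fun e => f e + g e) : E -> realC).
Proof.
apply: (@computable_pair_op2 realC (pairC rawC rawC) +%R
  (fun t u => (t.1 + u.1, t.2 + u.2))).
  move=> m E' f' h' fP hP; apply: computable_pair; apply: computable_raw_add;
  first [exact: computable_fst fP | exact: computable_fst hP
      | exact: computable_snd fP | exact: computable_snd hP].
by move=> c t u ct; exists (t.1 + u.1, t.2 + u.2); rewrite //= addrACA -opprD.
Qed.

Lemma computable_real_sub k (E : context k) (f g : E -> R) :
  computable (f : E -> realC) -> computable (g : E -> realC) ->
  computable ((fun e => f e - g e) : E -> realC).
Proof.
apply: (@computable_pair_op2 realC (pairC rawC rawC) (fun x y => x - y)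
  (fun t u => (t.1 + u.2, t.2 + u.1))).
  move=> m E' f' h' fP hP; apply: computable_pair; apply: computable_raw_add;
  first [exact: computable_fst fP | exact: computable_fst hP
      | exact: computable_snd fP | exact: computable_snd hP].
move=> c t u ct; exists (t.1 + u.2, t.2 + u.1) => //=.
by rewrite opprB addrACA -opprD.
Qed.

Lemma computable_real_mul k (E : context k) (f g : E -> R) :
  computable (f : E -> realC) -> computable (g : E -> realC) ->
  computable ((fun e => f e * g e) : E -> realC).
Proof.
apply: (@computable_pair_op2 realC (pairC rawC rawC) *%R
  (fun t u => (t.1 * u.1 + t.2 * u.2, t.1 * u.2 + t.2 * u.1))).
  move=> m E' f' h' fP hP.
  apply: computable_pair; apply: computable_raw_add; apply: computable_raw_mul;
    first [exact: computable_fst fP | exact: computable_fst hP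
      | exact: computable_snd fP | exact: computable_snd hP].
move=> c t u ct; exists (t.1 * u.1 + t.2 * u.2, t.1 * u.2 + t.2 * u.1) => //=.
by rewrite mulrBl !mulrBr opprB addrACA -opprD.
Qed.

Lemma computable_real_eq k (E : context k) (f g : E -> R) :
  computable (f : E -> realC) -> computable (g : E -> realC) ->
  computable ((fun e => f e == g e) : E -> boolC).
Proof.
apply: (@computable_pair_op2 boolC boolC eq_op
  (fun t u => t.1 + u.2 == u.1 + t.2)).
  move=> m E' f' h' fP hP; apply: computable_raw_eq; apply: computable_raw_add;
  first [exact: computable_fst fP | exact: computable_fst hP
      | exact: computable_snd fP | exact: computable_snd hP].
by move=> c t u /= ->; rewrite subr_eq addrAC [in RHS]eq_sym subr_eq eq_sym.
Qed.

Definition rsum (n : nat) (f : nat -> R) : R := \sum_(i < n) f i.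

Lemma computable_rsum k (E : context k) (b : E -> nat) (f : E -> nat -> R) :
  computable ((fun=> 0) : E -> realC) -> computable (b : E -> natC) ->
  computable ((fun e => f e.1 e.2) : ext E natC -> realC) ->
  computable ((fun e => rsum (b e) (f e)) : E -> realC).
Proof.
move=> zP bP fP; apply: (@computable_ext _ _ realC
  (fun e => iteri (b e) (fun i (t : realC) => t + f e i) 0)).
  move=> e; rewrite /rsum; elim: (b e) => [|m IHm]; first by rewrite big_ord0.
  by rewrite big_ord_recr /= IHm.
apply: computable_iteri => //; apply: computable_real_add.
  exact/computable_weaken/computable_var.
exact: (@computable_weaken_under _ _ realC natC realC f fP).
Qed.

(** * Automata as inputs *)

Definition wfaC := Coded (fun c (A : wfa nat) =>
  c = encode_wfa A /\ well_coded N A).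
(* Without states there is no entry, and possibly no code of any number at all. *)
Definition pos_wfaC := Coded (fun c (A : wfa nat) =>
  [/\ c = encode_wfa A, well_coded N A & (0 < nstates A)%N]).

Lemma computable_nstates k (E : context k) (A : E -> wfa nat) :
  computable (A : E -> wfaC) ->
  computable ((fun e => nstates (A e)) : E -> natC).
Proof.
apply: (@computable_realize1 wfaC natC (@nstates nat) headn computable_headn).
by move=> _ t [-> _]; exact: headnK.
Qed.

Lemma pos_wfaC_wfaC k (E : context k) (A : E -> wfa nat) :
  computable (A : E -> pos_wfaC) -> computable (A : E -> wfaC).
Proof.
by apply: computable_refine => e v ev; exists e => // c [cE cN _].
Qed.

(** The default is the first entry rather than 0, so that for a well coded automaton with a state
    even a reading out of range returns the value of a code. *)
Definition entry (A : wfa nat) (i : nat) : R :=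
  nth (value N (head 0 (wfa_entries A))) (map (value N) (wfa_entries A)) i.

Lemma wfa_entries_neq_nil (A : wfa nat) :
  (0 < nstates A)%N -> wfa_entries A != [::].
Proof.
move=> n0; rewrite -size_eq0 -lt0n size_cat size_map size_enum_ord.
by rewrite (leq_trans n0) ?leq_addr.
Qed.

Lemma computable_raw_entry k (E : context k) (A : E -> wfa nat) (i : E -> nat) :
  computable (A : E -> pos_wfaC) -> computable (i : E -> natC) ->
  computable ((fun e => entry (A e) (i e)) : E -> rawC).
Proof.
move=> AP iP; apply: computable_nth => //.
  apply: (@computable_realize1 pos_wfaC rawC
    (fun A => value N (head 0 (wfa_entries A))) (headn \o beheadn) _ _ _ _ _ AP).
    by move=> m E' f fP; exact/computable_headn/computable_beheadn.
  move=> _ t [-> cN /wfa_entries_neq_nil].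
  rewrite /comp [beheadn _]beheadnK; move: cN; rewrite /well_coded.
  case: (wfa_entries t) => [//|a s] cN _; rewrite [headn _]headnK /=.
  by split=> //; apply: cN; rewrite mem_head.
apply: (@computable_realize1 pos_wfaC (seqC rawC)
    (fun A => map (value N) (wfa_entries A)) beheadn _ _ _ _ _ AP).
  exact: computable_beheadn.
move=> _ t [-> cN _]; rewrite [beheadn _]beheadnK; move: cN; rewrite /well_coded.
elim: (wfa_entries t) => //= a s IHs cN; exists (a, CodeSeq.code s) => //=; split.
  by split=> //; apply: cN; rewrite mem_head.
by apply: IHs => c cs; apply: cN; rewrite inE cs orbT.
Qed.
End ExactReals.

(** * The decision procedure *)

Ltac lift_computable H :=
  first [ exact H
        | exact (computable_weaken _ H)
        | exact (computable_weaken _ (computable_weaken _ H))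
        | exact (computable_weaken _ (computable_weaken _ (computable_weaken _ H)))
        | exact (computable_weaken _ (computable_weaken _ (computable_weaken _
            (computable_weaken _ H)))) ].

Ltac computable_atom :=
  match goal with
  | H : computable _ |- _ => lift_computable H
  | |- _ => first
      [ exact: computable_zero
      | exact (computable_var _ _)
      | exact (computable_weaken _ (computable_var _ _))
      | exact (computable_weaken _ (computable_weaken _ (computable_var _ _)))
      | exact (computable_weaken _ (computable_weaken _ (computable_weaken _
          (computable_var _ _)))) ]
  end.

Section DecisionProcedure.
Variables (R : realType) (N : exact_numbers R).
Local Open Scope ring_scope.

Local Notation entry := (entry N).
Local Notation realC := (realC N).
Local Notation vecC := (seqC realC).

Definition dot (d : nat) (s t : seq R) : R :=
  rsum d (fun i => nth 0 s i * nth 0 t i).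

(** The matrices come after the [n + n] entries of [init] and [final], row by row, that of letter 0
    first; [a] is read as 0 or 1. *)
Definition trans_entry (A : wfa nat) (a : bool) (i j : nat) : R :=
  let n := nstates A in entry A (n + n + a * (n * n) + i * n + j)%N.

Definition init_seq (A : wfa nat) : seq R := mkseq (entry A) (nstates A).

Definition final_seq (A : wfa nat) : seq R :=
  mkseq (fun i => entry A (nstates A + i)%N) (nstates A).

Definition act (A : wfa nat) (a : bool) (t : seq R) : seq R :=
  mkseq (fun i => rsum (nstates A) (fun j => trans_entry A a i j * nth 0 t j))
    (nstates A).

Definition act_pow (A : wfa nat) (a : bool) (m : nat) (t : seq R) : seq R :=
  iteri m (fun _ => act A a) t.

(** A word of length [l] is read off the [l] lowest binary digits of [w]. In [act_bits] digit 0 acts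
    first on the vector, so it is the last letter of the word. *)
Definition bit (w s : nat) : bool := odd (w %/ 2 ^ s).

Definition act_bits (A : wfa nat) (l w : nat) (t : seq R) : seq R :=
  iteri l (fun s => act A (bit w s)) t.

(** With v the word given by [l] and [w], and b the letter other than [a], this is I A_v A_b A_a^m
    F; hence [bits_gap] is c_v(m). *)
Definition bits_branch (A : wfa nat) (l w m : nat) (a : bool) : R :=
  dot (nstates A) (init_seq A)
    (act_bits A l w (act A (~~ a) (act_pow A a m (final_seq A)))).

Definition bits_gap (A : wfa nat) (l w m : nat) : R :=
  bits_branch A l w m false - bits_branch A l w m true.

(* The limit of [c] is 0 iff row [0] is a linear combination of the others. *)
Definition gap_rows (d : nat) (c : nat -> R) : seq (seq R) :=
  mkseq (fun j => mkseq (fun i =>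
    if j == 0%N then c i else c (i + j)%N - c (i + j.-1)%N) d) d.+1.

(** A Gram-Schmidt step cleared of denominators: [r] is made orthogonal to [y] and scaled by the
    squared length of [y]. *)
Definition reduce (d : nat) (y r : seq R) : seq R :=
  mkseq (fun i => if dot d y y == 0 then nth 0 r i
                  else dot d y y * nth 0 r i - dot d r y * nth 0 y i) d.

(** Round [k] reduces all rows by the pivot row [k.+1]; row 0 never serves as pivot. *)
Definition eliminate (d m : nat) (rows : seq (seq R)) : seq (seq R) :=
  iteri m (fun k rs =>
    mkseq (fun j => reduce d (nth [::] rs k.+1) (nth [::] rs j)) d.+1) rows.

Definition limit0_test (d : nat) (c : nat -> R) : bool :=
  let r := nth [::] (eliminate d d (gap_rows d c)) 0 in dot d r r == 0.

(** The order [n + n] is the degree of P. The bound [2 ^ n] on [w] serves all lengths at once, so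
    that shorter words are tested repeatedly. *)
Definition decide (A : wfa nat) : bool :=
  let n := nstates A in
  all (fun l => all (fun w => limit0_test (n + n) (bits_gap A l w))
    (iota 0 (2 ^ n))) (iota 0 n.+1).

(** * Computability of the procedure *)

Lemma computable_real0_wfa k (E : context k) (A : E -> wfa nat) :
  computable (A : E -> pos_wfaC N) -> computable ((fun=> 0) : E -> realC).
Proof.
move=> AP.
exact: (computable_real0 (computable_raw_entry AP (computable_zero E))).
Qed.

Lemma computable_nstates_pos k (E : context k) (A : E -> wfa nat) :
  computable (A : E -> pos_wfaC N) ->
  computable ((fun e => nstates (A e)) : E -> natC).
Proof. by move=> AP; exact: computable_nstates (pos_wfaC_wfaC AP). Qed.

Lemma computable_entry k (E : context k) (A : E -> wfa nat) (i : E -> nat) :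
  computable (A : E -> pos_wfaC N) -> computable (i : E -> natC) ->
  computable ((fun e => entry (A e) (i e)) : E -> realC).
Proof. by move=> AP iP; apply/computable_raw_real/computable_raw_entry. Qed.

Lemma computable_real_nth k (E : context k) (s : E -> seq R) (i : E -> nat) :
  computable ((fun=> 0) : E -> realC) ->
  computable (s : E -> vecC) -> computable (i : E -> natC) ->
  computable ((fun e => nth 0 (s e) (i e)) : E -> realC).
Proof. exact: computable_nth. Qed.

Lemma computable_dot k (E : context k) (d : E -> nat) (s t : E -> seq R) :
  computable ((fun=> 0) : E -> realC) ->
  computable (d : E -> natC) -> computable (s : E -> vecC) ->
  computable (t : E -> vecC) ->
  computable ((fun e => dot (d e) (s e) (t e)) : E -> realC).
Proof.
move=> zP dP sP tP; apply: computable_rsum => //.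
by apply: computable_real_mul; apply: computable_real_nth; computable_atom.
Qed.

Lemma computable_trans_entry k (E : context k) (A : E -> wfa nat)
    (a : E -> bool) (i j : E -> nat) :
  computable (A : E -> pos_wfaC N) -> computable (a : E -> boolC) ->
  computable (i : E -> natC) -> computable (j : E -> natC) ->
  computable ((fun e => trans_entry (A e) (a e) (i e) (j e)) : E -> realC).
Proof.
move=> AP /computable_bool aP iP jP; have nP := computable_nstates_pos AP.
apply: computable_entry => //; do ![apply: computable_addn => //];
  do ![apply: computable_muln => //].
Qed.

Lemma computable_init_seq k (E : context k) (A : E -> wfa nat) :
  computable (A : E -> pos_wfaC N) ->
  computable ((fun e => init_seq (A e)) : E -> vecC).
Proof.
move=> AP; apply: (@computable_mkseq _ _ realC).
  exact: computable_nstates_pos.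
by apply: computable_entry; computable_atom.
Qed.

Lemma computable_final_seq k (E : context k) (A : E -> wfa nat) :
  computable (A : E -> pos_wfaC N) ->
  computable ((fun e => final_seq (A e)) : E -> vecC).
Proof.
move=> AP; have nP := computable_nstates_pos AP.
apply: (@computable_mkseq _ _ realC) => //.
by apply: computable_entry; [|apply: computable_addn]; computable_atom.
Qed.

Lemma computable_act k (E : context k) (A : E -> wfa nat) (a : E -> bool)
    (t : E -> seq R) :
  computable (A : E -> pos_wfaC N) -> computable (a : E -> boolC) ->
  computable (t : E -> vecC) ->
  computable ((fun e => act (A e) (a e) (t e)) : E -> vecC).
Proof.
move=> AP aP tP.
have nP := computable_nstates_pos AP; have zP := computable_real0_wfa AP.
apply: (@computable_mkseq _ _ realC) => //.
apply: (@computable_rsum R N _ (ext E natC) (fun e => nstates (A e.1))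
  (fun e j => trans_entry (A e.1) (a e.1) e.2 j * nth 0 (t e.1) j)) => //;
  try computable_atom.
apply: computable_real_mul.
  by apply: computable_trans_entry; computable_atom.
by apply: computable_real_nth; computable_atom.
Qed.

Lemma computable_act_pow k (E : context k) (A : E -> wfa nat) (a : E -> bool)
    (m : E -> nat) (t : E -> seq R) :
  computable (A : E -> pos_wfaC N) -> computable (a : E -> boolC) ->
  computable (m : E -> natC) -> computable (t : E -> vecC) ->
  computable ((fun e => act_pow (A e) (a e) (m e) (t e)) : E -> vecC).
Proof.
move=> AP aP mP tP; apply: (@computable_iteri _ _ vecC) => //.
by apply: computable_act; computable_atom.
Qed.

Lemma computable_act_bits k (E : context k) (A : E -> wfa nat)
    (l w : E -> nat) (t : E -> seq R) :
  computable (A : E -> pos_wfaC N) -> computable (l : E -> natC) ->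
  computable (w : E -> natC) -> computable (t : E -> vecC) ->
  computable ((fun e => act_bits (A e) (l e) (w e) (t e)) : E -> vecC).
Proof.
move=> AP lP wP tP; apply: (@computable_iteri _ _ vecC) => //.
apply: computable_act; try computable_atom.
apply: computable_odd; apply: computable_divn; first by computable_atom.
by apply: computable_exp2; computable_atom.
Qed.

Lemma computable_bits_branch k (E : context k) (A : E -> wfa nat)
    (l w m : E -> nat) (a : bool) :
  computable (A : E -> pos_wfaC N) -> computable (l : E -> natC) ->
  computable (w : E -> natC) -> computable (m : E -> natC) ->
  computable ((fun e => bits_branch (A e) (l e) (w e) (m e) a) : E -> realC).
Proof.
move=> AP lP wP mP.
have letterP (b : bool) : computable ((fun=> b) : E -> boolC).
  by apply/computable_bool; exact: computable_const.
apply: computable_dot;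
  [exact: computable_real0_wfa AP | exact: computable_nstates_pos |
  exact: computable_init_seq |].
apply/computable_act_bits/computable_act/computable_act_pow => //.
exact: computable_final_seq.
Qed.

Lemma computable_bits_gap k (E : context k) (A : E -> wfa nat)
    (l w m : E -> nat) :
  computable (A : E -> pos_wfaC N) -> computable (l : E -> natC) ->
  computable (w : E -> natC) -> computable (m : E -> natC) ->
  computable ((fun e => bits_gap (A e) (l e) (w e) (m e)) : E -> realC).
Proof.
by move=> AP lP wP mP; apply: computable_real_sub; exact: computable_bits_branch.
Qed.

Lemma computable_reduce k (E : context k) (d : E -> nat) (y r : E -> seq R) :
  computable ((fun=> 0) : E -> realC) ->
  computable (d : E -> natC) -> computable (y : E -> vecC) ->
  computable (r : E -> vecC) ->
  computable ((fun e => reduce (d e) (y e) (r e)) : E -> vecC).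
Proof.
move=> zP dP yP rP; apply: (@computable_mkseq _ _ realC) => //.
have yyP := computable_dot zP dP yP yP; have ryP := computable_dot zP dP rP yP.
apply: computable_if; first by apply: computable_real_eq; computable_atom.
  by apply: computable_real_nth; computable_atom.
by apply: computable_real_sub; apply: computable_real_mul; try computable_atom;
  apply: computable_real_nth; computable_atom.
Qed.

Lemma computable_eliminate k (E : context k) (d m : E -> nat)
    (rows : E -> seq (seq R)) :
  computable ((fun=> 0) : E -> realC) ->
  computable (d : E -> natC) -> computable (m : E -> natC) ->
  computable (rows : E -> seqC vecC) ->
  computable ((fun e => eliminate (d e) (m e) (rows e)) : E -> seqC vecC).
Proof.
move=> zP dP mP rP; apply: (@computable_iteri _ _ (seqC vecC)) => //.
apply: (@computable_mkseq _ (ext (ext E (seqC vecC)) natC) vecC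
  (fun e => (d e.1.1).+1)
  (fun e j => reduce (d e.1.1) (nth [::] e.1.2 e.2.+1) (nth [::] e.1.2 j))).
  by apply: computable_succ; computable_atom.
apply: computable_reduce; try computable_atom;
  apply: (@computable_nth _ _ vecC); try computable_atom; try exact: computable_nil.
by apply: computable_succ; computable_atom.
Qed.

Lemma computable_gap_rows k (E : context k) (d : E -> nat) (c : E -> nat -> R) :
  computable (d : E -> natC) ->
  computable ((fun e => c e.1 e.2) : ext E natC -> realC) ->
  computable ((fun e => gap_rows (d e) (c e)) : E -> seqC vecC).
Proof.
move=> dP cP; apply: (@computable_mkseq _ _ vecC).
  by apply: computable_succ.
apply: (@computable_mkseq _ (ext E natC) realC (fun e => d e.1)
  (fun e i => if e.2 == 0%N then c e.1 i
              else c e.1 (i + e.2)%N - c e.1 (i + e.2.-1)%N)).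
  by computable_atom.
have c1P : computable ((fun e => c e.1.1 e.2) : ext (ext E natC) natC -> realC).
  exact: (@computable_weaken_under _ E natC natC realC c cP).
have c2P : computable
    ((fun e => c e.1.1.1 e.2) : ext (ext (ext E natC) natC) natC -> realC).
  exact: (@computable_weaken_under _ (ext E natC) natC natC realC
    (fun e i => c e.1 i) c1P).
(* Evaluation of [c] at a computed index goes through a fresh variable, whence the twice weakened
   [c2P]. *)
have at_index (f : ext (ext E natC) natC -> nat) :
    computable (f : _ -> natC) ->
    computable ((fun e => c e.1.1 (f e)) : ext (ext E natC) natC -> realC).
  move=> fP; exact: (computable_let fP c2P).
apply: computable_if; [apply: computable_eq0; computable_atom | by [] |].
apply: computable_real_sub; apply: at_index; apply: computable_addn;
  try computable_atom.
by apply: computable_pred; computable_atom.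
Qed.

Lemma computable_limit0_test k (E : context k) (d : E -> nat)
    (c : E -> nat -> R) :
  computable ((fun=> 0) : E -> realC) -> computable (d : E -> natC) ->
  computable ((fun e => c e.1 e.2) : ext E natC -> realC) ->
  computable ((fun e => limit0_test (d e) (c e)) : E -> boolC).
Proof.
move=> zP dP cP; apply: (computable_real_eq (N := N)) => //.
have rP : computable ((fun e =>
    nth [::] (eliminate (d e) (d e) (gap_rows (d e) (c e))) 0) : E -> vecC).
  apply: (@computable_nth _ _ vecC); first exact: computable_nil.
    by apply: computable_eliminate => //; exact: computable_gap_rows.
  exact: computable_zero.
exact: computable_dot.
Qed.

Lemma computable_decide k (E : context k) (A : E -> wfa nat) :
  computable (A : E -> pos_wfaC N) ->
  computable ((fun e => decide (A e)) : E -> boolC).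
Proof.
move=> AP; have nP := computable_nstates_pos AP; have zP := computable_real0_wfa AP.
apply: computable_all; first exact: computable_succ.
apply: (@computable_all _ (ext E natC) (fun e => 2 ^ nstates (A e.1))%N
  (fun e w => limit0_test (nstates (A e.1) + nstates (A e.1))
    (bits_gap (A e.1) e.2 w))).
  by apply: computable_exp2; computable_atom.
apply: (@computable_limit0_test _ (ext (ext E natC) natC)
  (fun e => nstates (A e.1.1) + nstates (A e.1.1))%N
  (fun e => bits_gap (A e.1.1) e.1.2 e.2)).
- by computable_atom.
- by apply: computable_addn; computable_atom.
- by apply: computable_bits_gap; computable_atom.
Qed.

(** Without states there may be no number to start from, so [decide] is run only on automata with a
    state; the others are accepted at once. *)
Lemma recfun_decide : exists p : recfun 1, forall A : wfa nat, well_coded N A ->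
  rec_eval p [tuple encode_wfa A] ((nstates A == 0)%N || decide A : nat).
Proof.
have AP := computable_var emp (wfaC N).
have [|||p pP] := @computable_if_lt 1 (ext emp (wfaC N)) boolC
  (fun e => ~~ (nstates e.2 == 0%N)) (fun e => decide e.2) (fun=> true).
- exact/computable_negb/computable_eq0/computable_nstates/AP.
- apply: computable_decide; apply: computable_refine AP => e v [ev].
  by rewrite -lt0n => n0; exists e => // c [cE cN].
- by apply/computable_bool; exact: computable_const.
exists p => A AN; have [|c + cE] := pP (tt, A) [tuple encode_wfa A].
  by rewrite /= theadE.
by rewrite cE /=; case: (nstates A == 0)%N.
Qed.
End DecisionProcedure.

(** * Limits of convergent linear recurrent sequences *)

Local Open Scope classical_set_scope.
Local Open Scope ring_scope.

Section RecurrentLimit.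
Variables (R : realType) (L : {poly R} -> R).
Hypothesis LD : forall p q, L (p + q) = L p + L q.
Hypothesis LZ : forall a p, L (a *: p) = a * L p.

Let L0 : L 0 = 0. Proof. by rewrite -[0 in LHS](scale0r 0) LZ mul0r. Qed.
Let LB p q : L (p - q) = L p - L q.
Proof. by rewrite -scaleN1r LD LZ mulN1r. Qed.
Let Lsum n (F : 'I_n -> {poly R}) : L (\sum_i F i) = \sum_i L (F i).
Proof. exact: (big_morph L LD L0). Qed.

(** A sequence c is encoded by the linear functional with [L 'X^k] = c(k). Multiplication by ['X] is
    then the shift, and [L ('X^k * s)] is the term of index k of s(shift) c. The limit follows by
    Horner's scheme, as a shift does not change it. *)
Lemma cvg_functional l s : (fun k => L 'X^k) @ \oo --> l ->
  (fun k => L ('X^k * s)) @ \oo --> s.[1] * l.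
Proof.
move=> cl; elim/poly_ind: s => [|s a IHs].
  by under eq_fun do rewrite mulr0 L0; rewrite horner0 mul0r; exact: cvg_cst.
rewrite !hornerE mulrDl; under eq_fun => k.
  rewrite mulrDr LD mulrA mulrAC -exprSr -[_ * a%:P]mulrC mul_polyC LZ.
  over.
apply: cvgD; last by apply: cvgM cl; exact: cvg_cst.
by rewrite -(cvg_shiftS (fun k => L ('X^k * s))) in IHs.
Qed.

(* Induction on [m], the step passing from [q] to [('X - 1) * q], which has
   value 0 at 1: differences vanish, and a constant sequence is its limit. *)
Lemma functional_constant l m q k : (fun k => L 'X^k) @ \oo --> l ->
  (forall r, L (('X - 1%:P) ^+ m * q * r) = 0) ->
  L ('X^k * q) = q.[1] * l.
Proof.
move=> cl; elim: m q k => [|m IHm] q k qP.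
all: have const : (fun j => L ('X^j * q)) = (fun=> L ('X^k * q)).
- have q0 r : L (q * r) = 0 by have := qP r; rewrite expr0 mul1r.
  by apply/funext => j; rewrite ![_ * q]mulrC !q0.
- have := cvg_functional (s := q) cl.
  by rewrite const => /(norm_cvg_unique (cvg_cst _)).
- have step j : L ('X^(j.+1) * q) = L ('X^j * q).
    apply/eqP; rewrite -subr_eq0 -LB.
    have -> : 'X^(j.+1) * q - 'X^j * q = 'X^j * (('X - 1%:P) * q).
      by rewrite mulrBl mul1r mulrBr mulrA -exprSr.
    rewrite IHm.
      by rewrite hornerM hornerXsubC subrr !mul0r.
    by move=> r; rewrite mulrA -exprSr qP.
  have from0 j : L ('X^j * q) = L ('X^0 * q) by elim: j => // j <-.
  by apply/funext => j; rewrite !from0.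
- have := cvg_functional (s := q) cl.
  by rewrite const => /(norm_cvg_unique (cvg_cst _)).
Qed.

Lemma monic_unit_factor (p : {poly R}) : p != 0 ->
  exists m, exists2 q, q.[1] != 0 & p = ('X - 1%:P) ^+ m * q.
Proof.
move=> p0; have [m [q]] := multiplicity_XsubC p 1; rewrite p0 /= => q1 pE.
by exists m; exists q; rewrite 1?mulrC.
Qed.

Variables (p : {poly R}) (d : nat).
Hypothesis p_monic : p \is monic.
Hypothesis size_p : size p = d.+1.
Hypothesis Lp : forall r, L (p * r) = 0.

Variable l : R.
Hypothesis cl : (fun k => L 'X^k) @ \oo --> l.

(** If the limit is 0, then q(shift) c vanishes; with q - q(1) = (X - 1) t, the sequence c is
    -1/q(1) times t(shift) applied to its differences. Conversely, h = 1 - (X - 1) sum_j b_j X^j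
    satisfies h(shift) c = 0 and h(1) = 1, so the limit is 0. *)
Lemma limit0_differences : l = 0 <->
  exists b : nat -> R, forall i, (i < d)%N ->
    L 'X^i = \sum_(j < d) b j * (L 'X^((i + j).+1) - L 'X^(i + j)).
Proof.
pose diff (b : nat -> R) : {poly R} := ('X - 1%:P) * \sum_(j < d) b j *: 'X^j.
have diffE b i : L ('X^i * diff b) =
    \sum_(j < d) b j * (L 'X^((i + j).+1) - L 'X^(i + j)).
  rewrite /diff !mulr_sumr Lsum; apply: eq_bigr => j _.
  rewrite -2!scalerAr LZ mulrBl mul1r mulrBr LB -exprS -!exprD.
  by rewrite addnS.
split=> [l0|[b bP]].
  have [m [q q1 pE]] := monic_unit_factor (monic_neq0 p_monic).
  have q0 : q != 0 by apply: contraNneq q1 => ->; rewrite horner0.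
  have Lq k : L ('X^k * q) = 0.
    rewrite (@functional_constant l m) ?l0 ?mulr0 -?[X in _ --> X]l0 // => r.
    by rewrite -pE Lp.
  have : root (q - q.[1]%:P) 1 by rewrite rootE !hornerE subrr.
  case/factor_theorem => t tE.
  (* As [q] divides [p], its degree is at most [d]; so [t] has degree below [d] and its coefficients
     fit into [d] unknowns. *)
  have size_t : (size t <= d)%N.
    have [->|t0] := eqVneq t 0; first by rewrite size_poly0.
    have : (size (q - q.[1]%:P)%R <= d.+1)%N.
      rewrite (leq_trans (size_polyD _ _)) // geq_max size_polyN -size_p.
      rewrite (leq_trans (size_polyC_leq1 _)) ?size_p // andbT -size_p.
      by rewrite dvdp_leq ?monic_neq0 // pE dvdp_mull.
    by rewrite tE size_mul ?polyXsubC_eq0 // size_XsubC addn2.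
  pose b (j : nat) := - q.[1]^-1 * t`_j.
  exists b => i _; rewrite -diffE.
  have -> : diff b = - q.[1]^-1 *: (q - q.[1]%:P).
    rewrite tE [t * _]mulrC scalerAr; congr (_ * _); apply/polyP => j.
    rewrite -(poly_def d b) coef_poly coefZ.
    by case: ltnP => // dj; rewrite nth_default ?mulr0 // (leq_trans size_t).
  rewrite -scalerAr LZ mulrBr LB Lq sub0r [_ * _%:P]mulrC mul_polyC LZ.
  by rewrite mulrNN mulKf.
(* The first [d] terms vanish by assumption; the others follow by reducing ['X^k] modulo [p], whose
   multiples [L] kills. *)
have Lh k : L ('X^k * (1 - diff b)) = 0.
  have Lh_small i : (i < d)%N -> L ('X^i * (1 - diff b)) = 0.
    by move=> id; rewrite mulrBr mulr1 LB diffE -bP // subrr.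
  rewrite (divp_eq 'X^k p) mulrDl LD mulrAC [_ * p]mulrC Lp add0r.
  have size_r : (size ('X^k %% p)%R <= d)%N.
    by rewrite -ltnS -size_p ltn_modp monic_neq0.
  rewrite -[_ %% p]coefK poly_def mulr_suml Lsum big1 // => i _.
  by rewrite -scalerAl LZ Lh_small ?mulr0 // (leq_trans (ltn_ord i)).
have := cvg_functional (s := 1 - diff b) cl.
under eq_fun do rewrite Lh.
rewrite !hornerE subrr mul0r subr0 mul1r.
by move=> /(norm_cvg_unique (cvg_cst _)).
Qed.
End RecurrentLimit.

(** * Elimination *)

Section Elimination.
Variables (R : realType).

Definition rv (d : nat) (s : seq R) : 'rV[R]_d := \row_i nth 0 s i.

Lemma dotE d s t : dot d s t = (rv d s *m (rv d t)^T) ord0 ord0.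
Proof. by rewrite mxE; apply: eq_bigr => i _; rewrite !mxE. Qed.

(** A sum of real squares vanishes only termwise, so one equality test recognises the zero
    vector. *)
Lemma dot_eq0 d s : (dot d s s == 0) = (rv d s == 0).
Proof.
rewrite psumr_eq0 => [|i _]; last by rewrite -expr2 sqr_ge0.
apply/allP/eqP => [s0|s0 i _]; last first.
  by have /rowP/(_ i) := s0; rewrite !mxE => ->; rewrite /= mulr0.
apply/rowP => i; rewrite !mxE; have := s0 i (mem_index_enum i).
by rewrite /= mulf_eq0 orbb => /eqP.
Qed.

Lemma rv_reduce d y r :
  rv d (reduce d y r) = if rv d y == 0 then rv d r
    else dot d y y *: rv d r - dot d r y *: rv d y.
Proof.
apply/rowP => i; rewrite mxE nth_mkseq // dot_eq0.
by case: ifP => _; rewrite !mxE.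
Qed.

(** All rows undergo the same linear map [Q], whose kernel is the span of the pivots used so far. A
    round with pivot x replaces [Q] by Q (c - y^T y), where y = x Q is nonzero and c = y y^T; the
    new factor kills exactly the line of y, so the kernel grows by x. *)
Lemma eliminateP d m rows : (m <= d)%N -> exists Q : 'M[R]_d,
  (forall j, (j <= d)%N ->
    rv d (nth [::] (eliminate d m rows) j) = rv d (nth [::] rows j) *m Q) /\
  (forall z : 'rV_d, z *m Q = 0 <->
    exists b : nat -> R, z = \sum_(i < m) b i *: rv d (nth [::] rows i.+1)).
Proof.
elim: m => [|m IHm] md.
  exists 1%:M; split=> [j _|z]; rewrite mulmx1 //.
  split=> [->|[b ->]]; last by rewrite big_ord0.
  by exists (fun=> 0); rewrite big_ord0.
have [Q [rowsQ kerQ]] := IHm (ltnW md).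
set es := eliminate d m rows in rowsQ.
have nthE j : (j <= d)%N -> nth [::] (eliminate d m.+1 rows) j =
    reduce d (nth [::] es m.+1) (nth [::] es j).
  by move=> jd; rewrite [eliminate d m.+1 rows]/= nth_mkseq.
set x := rv d (nth [::] rows m.+1); pose y := x *m Q.
have rv_y : rv d (nth [::] es m.+1) = y by rewrite rowsQ.
have dotzE (z t : 'rV[R]_d) : (z *m t^T) ord0 ord0 *: t = z *m (t^T *m t).
  by rewrite mulmxA {2}[z *m _]mx11_scalar mul_scalar_mx.
have kerS (z : 'rV[R]_d) : (exists a : R, (z - a *: x) *m Q = 0) <->
    exists b : nat -> R, z = \sum_(i < m.+1) b i *: rv d (nth [::] rows i.+1).
  split=> [[a /kerQ[b zE]]|[b]].
    exists (fun i => if i == m then a else b i).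
    rewrite big_ord_recr /= eqxx -/x; apply: (canRL (subrK _)); rewrite zE.
    by apply: eq_bigr => i _; rewrite ltn_eqF.
  rewrite big_ord_recr /= -/x => zE; exists (b m); apply/kerQ; exists b.
  by rewrite zE addrK.
(* If [y] is 0, the pivot already lies in the span and the round changes nothing. *)
have [y0|y0] := eqVneq y 0.
  exists Q; split=> [j jd|z].
    by rewrite nthE // rv_reduce rv_y y0 eqxx rowsQ.
  rewrite -kerS; split=> [zQ|[a]]; first by exists 0; rewrite scale0r subr0.
  by rewrite mulmxBl -scalemxAl -/y y0 scaler0 subr0.
pose c := (y *m y^T) ord0 ord0.
have c0 : c != 0.
  by rewrite /c -rv_y -dotE dot_eq0 rv_y.
(* [z] is in the new kernel iff [z *m Q] is a multiple of [y = x *m Q]. *)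
exists (c *: Q - Q *m (y^T *m y)); split=> [j jd|z].
  rewrite nthE // rv_reduce rv_y (negbTE y0) !dotE rv_y rowsQ // dotzE.
  by rewrite mulmxBr -scalemxAr (mulmxA _ Q).
rewrite -kerS mulmxBr -scalemxAr (mulmxA z Q) -dotzE; set a := (_ *m y^T) _ _.
split=> [zQ|[b]].
  (* [zQ] says that [c] times [z *m Q] is [a] times [y], which dictates the coefficient of [x]. *)
  exists (a / c); rewrite mulmxBl -scalemxAl -/y.
  apply: (scalerI c0); rewrite scaler0 scalerBr scalerA mulrCA mulfV // mulr1.
  exact: zQ.
rewrite mulmxBl -scalemxAl -/y => /eqP; rewrite subr_eq0 => /eqP zQ.
rewrite /a zQ -scalemxAl mxE -/c scalerA mulrC subrr.
by [].
Qed.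

Lemma nth_gap_rows d c j i : (j <= d)%N -> (i < d)%N ->
  nth 0 (nth [::] (gap_rows d c) j) i =
  if j == 0%N then c i else c (i + j)%N - c (i + j.-1)%N :> R.
Proof. by move=> jd id; rewrite nth_mkseq // nth_mkseq. Qed.

(** Row [j.+1] of [gap_rows] is the difference sequence shifted by [j]; by [eliminateP], row 0 is
    reduced to 0 exactly when it lies in the span of these rows. *)
Lemma limit0_testP d (c : nat -> R) : limit0_test d c <->
  exists b : nat -> R, forall i, (i < d)%N ->
    c i = \sum_(j < d) b j * (c (i + j).+1 - c (i + j)%N).
Proof.
have [Q [rowsQ kerQ]] := @eliminateP d d (gap_rows d c) (leqnn d).
rewrite /limit0_test dot_eq0 rowsQ //; split=> [/eqP/kerQ[b bE]|[b bE]].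
  exists b => i id; have /rowP/(_ (Ordinal id)) := bE.
  rewrite mxE nth_gap_rows // eqxx summxE => ->; apply: eq_bigr => j _.
  by rewrite !mxE nth_gap_rows //= addnS.
apply/eqP/kerQ; exists b; apply/rowP => i.
rewrite mxE nth_gap_rows // eqxx bE // summxE; apply: eq_bigr => j _.
by rewrite !mxE nth_gap_rows //= addnS.
Qed.
End Elimination.

(** * Words and matrices *)

Section WordProducts.
Variables (F : fieldType) (n : nat) (M : bool -> 'M[F]_n).

Definition word_mx (v : seq bool) : 'M[F]_n := \big[mulmx/1%:M]_(a <- v) M a.

Lemma word_mx_nil : word_mx [::] = 1%:M.
Proof. exact: big_nil. Qed.

Lemma word_mx_cons a v : word_mx (a :: v) = M a *m word_mx v.
Proof. exact: big_cons. Qed.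

Lemma word_mx_cat u v : word_mx (u ++ v) = word_mx u *m word_mx v.
Proof.
elim: u => [|a u IHu]; first by rewrite word_mx_nil mul1mx.
by rewrite cat_cons !word_mx_cons IHu mulmxA.
Qed.

Lemma word_mx_rcons v a : word_mx (rcons v a) = word_mx v *m M a.
Proof. by rewrite -cats1 word_mx_cat word_mx_cons word_mx_nil mulmx1. Qed.

(** The row space spanned by the vectors I A_v for words v of length at most [l]. *)
Fixpoint reach (I : 'rV[F]_n) (l : nat) : 'M[F]_n :=
  if l is l'.+1 then
    (reach I l' + reach I l' *m M false + reach I l' *m M true)%MS
  else <<I>>%MS.

(** In the induction the last letter of the word is absorbed into [y], which is therefore kept
    arbitrary. *)
Lemma reach_mul0 (I : 'rV_n) l m (y : 'M[F]_(n, m)) :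
  (forall v, (size v <= l)%N -> I *m word_mx v *m y = 0) ->
  reach I l *m y = 0.
Proof.
elim: l m y => [|l IHl] m y Iy /=.
  apply/sub_kermxP; rewrite genmxE; apply/sub_kermxP.
  by rewrite -[I]mulmx1 -word_mx_nil Iy.
apply/sub_kermxP; rewrite !addsmx_sub -andbA; apply/and3P; split; apply/sub_kermxP.
- by apply: IHl => v vl; rewrite Iy // leqW.
- rewrite -mulmxA; apply: IHl => v vl.
  by rewrite mulmxA -(mulmxA I) -word_mx_rcons Iy // size_rcons.
- rewrite -mulmxA; apply: IHl => v vl.
  by rewrite mulmxA -(mulmxA I) -word_mx_rcons Iy // size_rcons.
Qed.

(** Otherwise the rank would increase at each of the n + 1 steps from [reach I 0] to [reach I n.+1]
    and so exceed [n]. *)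
Lemma reach_stable I : exists2 l, (l <= n)%N & (reach I l.+1 <= reach I l)%MS.
Proof.
apply: contrapT => unstable.
have grow l : (l <= n.+1)%N -> (l <= \rank (reach I l))%N.
  elim: l => // l IHl ln; apply: leq_trans (_ : (\rank (reach I l)).+1 <= _)%N.
    by rewrite ltnS IHl // ltnW.
  have sub : (reach I l <= reach I l.+1)%MS by rewrite /= -addsmxA addsmxSl.
  rewrite ltn_neqAle mxrankS // andbT; apply/negP => /eqP rankE.
  apply: unstable; exists l => //.
  by rewrite -(mxrank_leqif_sup sub) rankE.
by have := grow _ (leqnn _); rewrite leqNgt ltnS rank_leq_row.
Qed.

(** Once stable, [reach] is invariant under both letters and so contains every I A_v; [y] kills it
    because [y] kills the vectors of the short words. *)
Lemma word_mx_bounded (I : 'rV_n) m (y : 'M[F]_(n, m)) :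
  (forall v, (size v <= n)%N -> I *m word_mx v *m y = 0) ->
  forall v, I *m word_mx v *m y = 0.
Proof.
move=> Iy v; have [l ln] := reach_stable I.
rewrite /= !addsmx_sub => /andP[/andP[_ s0] s1].
have stable u : (reach I l *m word_mx u <= reach I l)%MS.
  elim: u => [|a u IHu]; first by rewrite word_mx_nil mulmx1.
  rewrite word_mx_cons mulmxA (submx_trans _ IHu) // submxMr //.
  by case: a.
have Il : (I <= reach I l)%MS.
  elim: (l) => [|l' IHl] /=; first by rewrite genmxE.
  by rewrite (submx_trans IHl) // -addsmxA addsmxSl.
apply/sub_kermxP; rewrite (submx_trans (submxMr _ Il)) //.
rewrite (submx_trans (stable v)) //.
by apply/sub_kermxP; apply: reach_mul0 => u ul; rewrite Iy // (leq_trans ul).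
Qed.
End WordProducts.

(** * The gap sequences c_v as linear functionals *)

Section LetterGap.
Variables (R : realType) (n' : nat).
Local Notation n := n'.+1.
Variables (M : bool -> 'M[R]_n) (F : 'cV[R]_n).

(** The sequence A_1 A_0^k F - A_0 A_1^k F, extended linearly from ['X^k] to all polynomials;
    [gap_value] at the row I A_v is thus the functional that encodes c_v. *)
Definition gap_vec (p : {poly R}) : 'cV[R]_n :=
  M true *m horner_mx (M false) p *m F - M false *m horner_mx (M true) p *m F.

Definition gap_value (u : 'rV[R]_n) (p : {poly R}) : R :=
  (u *m gap_vec p) ord0 ord0.

Lemma gap_valueD u p q : gap_value u (p + q) = gap_value u p + gap_value u q.
Proof.
rewrite /gap_value; have -> : gap_vec (p + q) = gap_vec p + gap_vec q.
  by rewrite /gap_vec !rmorphD /= !mulmxDr !mulmxDl opprD addrACA.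
by rewrite mulmxDr mxE.
Qed.

Lemma gap_valueZ u a p : gap_value u (a *: p) = a * gap_value u p.
Proof.
rewrite /gap_value; have -> : gap_vec (a *: p) = a *: gap_vec p.
  by rewrite /gap_vec !horner_mxZ -!scalemxAr -!scalemxAl -scalerBr.
by rewrite -scalemxAr mxE.
Qed.

Definition gap_poly : {poly R} := char_poly (M false) * char_poly (M true).

Lemma gap_poly_monic : gap_poly \is monic.
Proof. by rewrite monicMl ?char_poly_monic. Qed.

Lemma size_gap_poly : size gap_poly = (n + n).+1.
Proof.
by rewrite size_Mmonic ?monic_neq0 ?char_poly_monic // !size_char_poly addSn addnS.
Qed.

Lemma gap_value_poly u r : gap_value u (gap_poly * r) = 0.
Proof.
rewrite /gap_value /gap_vec !rmorphM /= !Cayley_Hamilton.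
by rewrite mulr0 !mul0r !mulmx0 !mul0mx subr0 mulmx0 mxE.
Qed.

Variables (I : 'rV[R]_n) (l : word -> R).
Hypothesis cvg_l : forall v,
  (fun k => gap_value (I *m word_mx M v) 'X^k) @ \oo --> l v.

Lemma gap_limits0 :
  (forall v, l v = 0) <->
  (forall v, (size v <= n)%N ->
     limit0_test (n + n) (fun k => gap_value (I *m word_mx M v) 'X^k)).
Proof.
have testP v : limit0_test (n + n) (fun k => gap_value (I *m word_mx M v) 'X^k)
    <-> l v = 0.
  rewrite limit0_testP; apply: iff_sym.
  exact: (limit0_differences (gap_valueD _) (gap_valueZ _) gap_poly_monic
    size_gap_poly (gap_value_poly _) (@cvg_l v)).
split=> [l0 v _|tests v]; first by apply/testP.
have [m [q q1 pE]] := monic_unit_factor (monic_neq0 gap_poly_monic).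
(* The vector y that reduces the question to short words is [gap_vec q], the same for all words; the
   limits are recovered because [q.[1]] is nonzero. *)
have lE u : gap_value (I *m word_mx M u) q = q.[1] * l u.
  have const := @functional_constant R _ (gap_valueD _) (gap_valueZ _) (l u) m q.
  have := const _ 0%N (@cvg_l u); rewrite expr0 mul1r; apply=> r.
  by rewrite -pE gap_value_poly.
apply: (mulfI q1); rewrite mulr0 -lE /gap_value.
rewrite word_mx_bounded ?mxE // => u un.
apply/matrixP => i j; rewrite !ord1 -/(gap_value _ q) lE.
by rewrite ((testP u).1 (tests u un)) mulr0 mxE.
Qed.
End LetterGap.

(** * Correctness *)


Lemma nth_allpairs (T U V : Type) (f : T -> U -> V) (x : T) (y : U) (z : V)
    s t i j :
  (i < size s)%N -> (j < size t)%N ->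
  nth z [seq f a b | a <- s, b <- t] (i * size t + j) = f (nth x s i) (nth y t j).
Proof.
elim: s i => [//|a s IHs] [|i] /= ilt jlt; rewrite nth_cat size_map.
  by rewrite add0n jlt (nth_map y).
by rewrite mulSn -addnA ltnNge leq_addr /= addKn IHs.
Qed.

Fixpoint bits_word (l w : nat) : word :=
  if l is l'.+1 then bit w l' :: bits_word l' w else [::].

Lemma size_bits_word l w : size (bits_word l w) = l.
Proof. by elim: l => //= l ->. Qed.

Lemma bits_word_surj v : exists2 w, (w < 2 ^ size v)%N & bits_word (size v) w = v.
Proof.
elim: v => [|a v [w wlt wv]]; first by exists 0%N.
(* The new first letter becomes the digit of weight [2 ^ size v], the highest one. *)
exists (a * 2 ^ size v + w)%N.
  rewrite /= expnS mul2n -addnn.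
  by case: a; rewrite ?mul1n ?ltn_add2l ?(ltn_addr _ wlt).
rewrite /= {1}/bit divnMDl ?expn_gt0 // divn_small // addn0 oddb; congr (_ :: _).
suff low l : (l <= size v)%N -> bits_word l (a * 2 ^ size v + w) = bits_word l w.
  by rewrite low.
elim: l => //= l IHl lv; rewrite IHl ?(ltnW lv) //; congr (_ :: _).
(* Shifted down by [l < size v] places, the added term is still even and does not affect the
   parity. *)
rewrite /bit -(subnK lv) addnS -addSn expnD mulnA divnMDl ?expn_gt0 //.
by rewrite oddD oddM oddX /= andbF.
Qed.

Section Correctness.
Variables (R : realType) (N : exact_numbers R).

Section Entries.
Variables (A : wfa nat).
Let n := nstates A.
Let entryE i c : (i < size (wfa_entries A))%N -> nth 0%N (wfa_entries A) i = c ->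
  entry N A i = value N c.
Proof. by move=> ilt <-; rewrite /entry (nth_map 0%N). Qed.

Let size_entries : size (wfa_entries A) = (n + (n + (n * n + n * n)))%N.
Proof.
by rewrite !size_cat 2!size_map !size_allpairs !size_enum_ord.
Qed.

Lemma entry_init (i : 'I_n) : entry N A i = value N (init A ord0 i).
Proof.
apply: entryE; first by rewrite size_entries ltn_addr.
rewrite nth_cat size_map size_enum_ord ltn_ord.
by rewrite (nth_map i) ?size_enum_ord ?nth_ord_enum.
Qed.

Lemma entry_final (i : 'I_n) : entry N A (n + i) = value N (final A i ord0).
Proof.
apply: entryE; first by rewrite size_entries ltn_add2l ltn_addr.
rewrite nth_cat size_map size_enum_ord ltnNge leq_addr /= addKn.
rewrite nth_cat size_map size_enum_ord ltn_ord.
by rewrite (nth_map i) ?size_enum_ord ?nth_ord_enum.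
Qed.

Lemma trans_entryE a (i j : 'I_n) :
  trans_entry N A a i j = value N (trans A a i j).
Proof.
have ij : (i * n + j < n * n)%N.
  rewrite (leq_trans (_ : _ < i.+1 * n)%N) ?leq_mul2r ?ltn_ord ?orbT //.
  by rewrite mulSn addnC ltn_add2r.
rewrite /trans_entry -/n -!addnA; apply: entryE.
  rewrite size_entries !ltn_add2l; case: a; last exact: ltn_addr.
  by rewrite mul1n ltn_add2l.
rewrite nth_cat size_map size_enum_ord ltnNge leq_addr /= addKn.
rewrite nth_cat size_map size_enum_ord ltnNge leq_addr /= addKn.
rewrite nth_cat size_allpairs size_enum_ord.
have allpairsE b : nth 0%N [seq trans A b i j | i <- enum 'I_n, j <- enum 'I_n]
    (i * n + j) = trans A b i j.
  have := @nth_allpairs _ _ _ (trans A b) i j 0%N (enum 'I_n) (enum 'I_n) i j.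
  by rewrite !size_enum_ord !nth_ord_enum => ->.
case: a; last by rewrite -[(false * _ + _)%N]/(i * n + j)%N ij allpairsE.
by rewrite mul1n ltnNge leq_addr /= addKn allpairsE.
Qed.
End Entries.

Section Semantics.
Variables (n' : nat) (I0 : 'rV[nat]_n'.+1) (F0 : 'cV[nat]_n'.+1)
  (T0 : bool -> 'M[nat]_n'.+1).
Let A := WFA I0 F0 T0.
Let W := denote_wfa N A.
Local Notation n := n'.+1.
Let M : bool -> 'M[R]_n := trans W.
Let F : 'cV[R]_n := final W.
Let I : 'rV[R]_n := init W.

Let cv (s : seq R) : 'cV[R]_n := (rv n s)^T.

Let cv_act a t : cv (act N A a t) = M a *m cv t.
Proof.
apply/colP => i; rewrite !mxE nth_mkseq //; apply: eq_bigr => j _.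
by rewrite trans_entryE !mxE.
Qed.

Let cv_final : cv (final_seq N A) = F.
Proof. by apply/colP => i; rewrite !mxE nth_mkseq // entry_final. Qed.

Let rv_init : rv n (init_seq N A) = I.
Proof. by apply/rowP => i; rewrite !mxE nth_mkseq // entry_init. Qed.

Let cv_act_pow a m t : cv (act_pow N A a m t) = M a ^+ m *m cv t.
Proof.
elim: m => [|m IHm]; first by rewrite expr0 mul1mx.
by rewrite [act_pow _ _ _ _ _]/= cv_act IHm mulmxA exprS.
Qed.

Let cv_act_bits l w t :
  cv (act_bits N A l w t) = word_mx M (bits_word l w) *m cv t.
Proof.
elim: l => [|l IHl]; first by rewrite word_mx_nil mul1mx.
by rewrite [act_bits _ _ _ _ _]/= cv_act IHl mulmxA -word_mx_cons.
Qed.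

Lemma bits_gapE l w m : bits_gap N A l w m =
  gap_value M F (I *m word_mx M (bits_word l w)) 'X^m.
Proof.
rewrite /bits_gap /bits_branch !dotE -!/(cv _) rv_init.
rewrite !cv_act_bits !cv_act !cv_act_pow cv_final.
rewrite /gap_value /gap_vec !rmorphXn /= !horner_mx_X mulmxBr -!mulmxA.
by rewrite [RHS]mxE; congr (_ + _); rewrite [RHS]mxE.
Qed.

Lemma decideP : decide N A <-> forall v, (size v <= n)%N ->
  limit0_test (n + n) (fun k => gap_value M F (I *m word_mx M v) 'X^k).
Proof.
have testE l w : limit0_test (n + n) (bits_gap N A l w) = limit0_test (n + n)
    (fun k => gap_value M F (I *m word_mx M (bits_word l w)) 'X^k).
  by congr limit0_test; apply/funext => k; rewrite bits_gapE.
split=> [/allP tests v vn|tests].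
  have [w wlt wv] := bits_word_surj v; rewrite -wv -testE.
  have /tests/allP : size v \in iota 0 n.+1 by rewrite mem_iota.
  by apply; rewrite mem_iota (leq_trans wlt) // leq_pexp2l.
apply/allP => l; rewrite mem_iota => /andP[_ ln]; apply/allP => w _.
by rewrite testE tests // size_bits_word.
Qed.

(** A prefix that reaches past [rcons v a], whose length is the offset [(size v).+1], continues with
    a power of [b]. *)
Lemma prefix_value_eventually v a b k :
  prefix_value W (cat_oword (rcons v a) (omega_letter b)) (k + (size v).+1) =
  (I *m word_mx M v *m M a *m M b ^+ k *m F) ord0 ord0.
Proof.
rewrite /prefix_value; have -> : pref (k + (size v).+1)
    (cat_oword (rcons v a) (omega_letter b)) = rcons v a ++ nseq k b.
  apply: (@eq_from_nth _ false).
    by rewrite size_mkseq size_cat size_rcons size_nseq addnC.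
  rewrite size_mkseq => i ilt; rewrite nth_mkseq // nth_cat /cat_oword.
  case: ltnP => // ige; rewrite nth_nseq size_rcons.
  by rewrite ltn_subLR ?(addnC _ k) ?ilt // -(size_rcons v a).
rewrite -[trans_word _ _]/(word_mx M _) word_mx_cat word_mx_rcons.
rewrite !mulmxA; congr ((_ *m _ *m _) _ _).
by elim: k => [|k IHk]; rewrite ?word_mx_nil // word_mx_cons IHk exprS.
Qed.

(** Here [lim_of v a] is the value at v a followed by the other letter forever, so the limit of c_v
    is the difference of the two sides of the condition. *)
Lemma decide_compatible : (forall w, omega_defined W w) ->
  decide N A <-> binary_compatible W.
Proof.
move=> W_cvg; pose lim_of v a :=
  omega_fun W (cat_oword (rcons v a) (omega_letter (~~ a))).
have cvg_lim_of v a :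
    (fun k => (I *m word_mx M v *m M a *m M (~~ a) ^+ k *m F) ord0 ord0) @ \oo
      --> lim_of v a.
  have := W_cvg (cat_oword (rcons v a) (omega_letter (~~ a))).
  rewrite /omega_defined -(cvg_shiftn (size v).+1) /=.
  by under eq_fun do rewrite prefix_value_eventually.
rewrite decideP -(gap_limits0 (l := fun v => lim_of v true - lim_of v false)).
  split=> lim0 v; last first.
    by have := lim0 v; rewrite !cats1 => /eqP; rewrite -subr_eq0 => /eqP.
  by apply/eqP; rewrite -subr_eq0 !cats1; apply/eqP; exact: lim0.
move=> v; apply: cvg_trans (cvgB (cvg_lim_of v true) (cvg_lim_of v false)).
apply: near_eq_cvg; apply: nearW => k /=.
rewrite /gap_value /gap_vec !rmorphXn /= !horner_mx_X mulmxBr !mulmxA.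
by rewrite [RHS]mxE; congr (_ + _); rewrite [RHS]mxE.
Qed.
End Semantics.
End Correctness.

Theorem lemma60 (R : realType) (N : exact_numbers R) :
  decidable_given encode_wfa
    (fun A : wfa nat =>
       well_coded N A /\
       average_preserving (denote_wfa N A) /\
       omega_continuous (denote_wfa N A))
    (fun A : wfa nat => binary_compatible (denote_wfa N A)).
Proof.
have [p pP] := recfun_decide N; exists p => A [/pP pA [_ [A_cvg _]]].
suff decideE : (nstates A == 0%N) || decide N A <->
    binary_compatible (denote_wfa N A).
  split=> [/decideE|] compat; first by rewrite compat in pA.
  by case: (_ || _) decideE pA => // -[/(_ isT)].
(* Without states every prefix value is an empty sum, so both sides of the condition are limits of
   the same sequence, in accordance with the outright acceptance. *)
case: A A_cvg {pA} => -[|n'] I0 F0 T0 A_cvg; last exact: decide_compatible.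
split=> // _ v; congr (limn _); apply/funext => k.
by rewrite /prefix_value !mxE !big_ord0.
Qed.
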